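(* Let $\{X_t\,|\,t\ge 0\}$ be a stationary, stochastically monotone, time-homogeneous real-valued Markov process, in either discrete time ($t$ ranging over the nonnegative integers) or continuous time ($t$ ranging over the nonnegative reals). Then for every Borel supermodular $h:\mathbb{R}^2\to\mathbb{R}$ for which the following expectations exist and are finite, $\mathbb{E}\,h(X_0,X_t)$ is nonincreasing in $t\ge 0$. In particular, when $f_1,f_2:\mathbb{R}\to\mathbb{R}$ are nondecreasing and the appropriate expectations (those of $f_1(X_0)$, $f_2(X_0)$ and $f_1(X_0)f_2(X_t)$, $t\ge 0$) exist and are finite, $\mathrm{Cov}(f_1(X_0),f_2(X_t))$ is nonnegative and nonincreasing in $t\ge 0$.
   Context: A Markov transition kernel $p(x,A)$ ($x\in\mathbb{R}$, $A\subset\mathbb{R}$ Borel) is such that $p(\cdot,A)$ is a Borel function for every Borel $A$ and $p(x,\cdot)$ is a probability measure for every $x$. It is stochastically monotone if $p(x,(y,\infty))$ is nondecreasing in $x$ for each $y\in\mathbb{R}$. A discrete-time time-homogeneous Markov process is stochastically monotone if its one-step transition kernel is stochastically monotone. A continuous-time time-homogeneous Markov process is stochastically monotone if $p^t(x,A)=\mathbb{P}_x(X_t\in A)$ is a stochastically monotone kernel for each $t>0$. A function $h:\mathbb{R}^2\to\mathbb{R}$ is supermodular if $h(x_1,y_2)+h(x_2,y_1)\le h(x_1,y_1)+h(x_2,y_2)$ whenever $x_1\le x_2$ and $y_1\le y_2$. *)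

(* Defs.v *)
From HB Require Import structures.
From mathcomp Require Import all_boot all_order all_algebra.
From mathcomp Require Import all_classical all_reals all_analysis.
From mathcomp Require Import measurable_realfun.

Set Implicit Arguments.
Unset Strict Implicit.
Unset Printing Implicit Defensive.

Import Order.TTheory GRing.Theory Num.Theory.
Import numFieldNormedType.Exports.

Local Open Scope classical_set_scope.
Local Open Scope ring_scope.
Local Open Scope ereal_scope.

Section kernels_and_functions.
Context (R : realType).

Definition stochastically_monotone (p : R.-pker R ~> R) :=
  forall y : R, {homo (fun x : R => p x `]y, +oo[%classic) : x1 x2 / (x1 <= x2)%R >-> x1 <= x2}.

Definition supermodular (h : R * R -> R) :=
  forall x1 x2 y1 y2 : R, (x1 <= x2)%R -> (y1 <= y2)%R ->
    (h (x1, y2) + h (x2, y1) <= h (x1, y1) + h (x2, y2))%R.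

Definition nng_add (s t : {nonneg R}) : {nonneg R} := (s%:num + t%:num)%:nng%R.

(* With p t x A standing for P_x(X_t \in A), these are the identities satisfied
   by the laws of X_t under the family (P_x)_x: X_0 = x under P_x, and the
   Chapman-Kolmogorov equations. *)
Definition transition_function (p : {nonneg R} -> R.-pker R ~> R) :=
  (forall (x : R) (A : set R), measurable A -> p 0%:nng%R x A = \d_x A) /\
  (forall (s t : {nonneg R}) (x : R) (A : set R), measurable A ->
    p (nng_add s t) x A = \int[p s x]_y p t y A).

End kernels_and_functions.

Section processes.
Context d (T : measurableType d) (R : realType) (P : probability T R).

(* Y is a version of the conditional probability P(E | F); the first conjunct
   is F-measurability of Y, F being a sub-sigma-algebra of the one on T. *)
Definition is_cond_prob (F : set (set T)) (E : set T) (Y : T -> \bar R) :=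
  (forall U : set (\bar R), measurable U -> F (Y @^-1` U)) /\
  (forall B : set T, F B -> \int[P]_(w in B) Y w = P (E `&` B)).

Definition history (I : Type) (X : I -> {RV P >-> R}) (S : set I) : set (set T) :=
  <<s \bigcup_(u in S) preimage_set_system setT (X u) measurable >>.

Definition stationary (I : Type) (add : I -> I -> I) (X : I -> {RV P >-> R}) :=
  forall (n : nat) (t : 'I_n -> I) (s : I) (B : set (n.-tuple R)),
    measurable B ->
    P ((fun w => [tuple X (add (t i) s) w | i < n]) @^-1` B) =
    P ((fun w => [tuple X (t i) w | i < n]) @^-1` B).

Definition discrete_markov (p : R.-pker R ~> R) (X : nat -> {RV P >-> R}) :=
  forall (n : nat) (A : set R), measurable A ->
    is_cond_prob (history X [set m | (m <= n)%N])
      (X n.+1 @^-1` A) (fun w => p (X n w) A).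

Definition continuous_markov (p : {nonneg R} -> R.-pker R ~> R)
    (X : {nonneg R} -> {RV P >-> R}) :=
  transition_function p /\
  forall (s t : {nonneg R}) (A : set R), measurable A ->
    is_cond_prob (history X [set u | (u%:num <= s%:num)%R])
      (X (nng_add s t) @^-1` A) (fun w => p t (X s w) A).

End processes.

(* Main.v *)
From HB Require Import structures.
Require Import Defs.
From mathcomp Require Import all_boot all_order all_algebra.
From mathcomp Require Import all_classical all_reals all_analysis.
From mathcomp Require Import measurable_realfun ring lra.

Set Implicit Arguments.
Unset Strict Implicit.
Unset Printing Implicit Defensive.

Import Order.TTheory GRing.Theory Num.Theory.
Import numFieldNormedType.Exports.

Local Open Scope classical_set_scope.
Local Open Scope ring_scope.
Local Open Scope ereal_scope.

(** Let [0 <= s <= t] and [r = t - s].  By stationarity [E h(X_0, X_s)] equals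
    [E h(X_r, X_t)], so the claim compares [E h(X_0, X_t)] with
    [E h(X_r, X_t)]: the variables [U = X_0] and [V = X_r] have the same law,
    and [Z = X_t] is drawn from a stochastically monotone kernel [p] at [V],
    independently of [U] given [V].

    A monotone kernel can be sampled monotonically: the upper quantile function
    [q(x, u)] of [p x] is nondecreasing in [x], and has law [p x] when [u] is
    uniform on the unit interval ([noise_sampler], [sampler_homo]).  Hence
    [(U, Z)] and [(V, Z)] have the laws of [(U, q(V, u))] and [(V, q(V, u))]
    with [u] independent of [(U, V)] ([joint_law_sampler]).  For a frozen [u]
    the function [k(x, y) = h(x, q(y, u))] is again supermodular and finite
    everywhere, and by Fubini it remains to show
    [E k(U, V) <= E k(V, V)] for two variables with the same law
    ([le_integral_supermodular]).

    That inequality is the optimality of the comonotone coupling.  No continuity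
    of [k] is available, nor is the integrability of [k(x, V)] for a fixed [x],
    so the proof goes through a dual potential: a supermodular [k] is cyclically
    monotone, which yields a measurable [g] such that
    [k(x, y) - k(y, y) <= g(x) - g(y)] ([supermodular_potential]).  Although [g]
    need not be integrable, truncating it at level [n] gives
    [E (g_n(U) - g_n(V)) = 0], and dominated convergence, with the integrable
    left-hand side as the dominating function, concludes
    ([integral_le0_potential]).

    For the covariances, [f1(x) f2(y)] is supermodular when [f1] and [f2] are
    nondecreasing, which gives monotonicity in time.  Nonnegativity is the
    association inequality [E f(V) E g(V) <= E f(V) g(V)]
    ([integral_mul_homo_ge]), itself the same coupling inequality applied to two
    independent copies of [V]; it is used for [g = f2(q(., u))] with [u] frozen.

    In discrete time only the one-step kernel is given.  Its iterates are
    monotone and describe the transitions over several steps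
    ([kernel_comp_mono], [cond_law_comp]). *)

(** * Cyclic monotonicity and the half-line potential *)

Section chains.
Context (R : realType) (k : R * R -> R).
Local Open Scope ring_scope.

Fixpoint chain_sum (x : R) (s : seq R) (y : R) : R :=
  if s is z :: s' then k (x, z) + chain_sum z s' y else k (x, y).

Lemma chain_sum_cat x s1 z s2 y :
  chain_sum x (s1 ++ z :: s2) y = chain_sum x s1 z + chain_sum z s2 y.
Proof. by elim: s1 x => //= a s1 IH x; rewrite IH addrA. Qed.

Hypotheses (k_super : supermodular k) (k_diag : forall x, k (x, x) = 0).

(** A maximal point [M] may be skipped: in a step [a -> M -> z] the exchange
    inequality at [a <= M] and [z <= M] bounds the gain by that of [a -> z]. *)
Lemma chain_sum_bypass x s M z : all (<= M) (x :: s) -> z <= M ->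
  chain_sum x s M + k (M, z) <= chain_sum x s z.
Proof.
elim: s x => [|a s IH] x /=.
  rewrite andbT => xM zM.
  by have := k_super xM zM; rewrite k_diag addr0.
by move=> /andP[xM asM] zM; rewrite -addrA lerD2l; exact: IH.
Qed.

Lemma exists_max (x : R) s : exists2 M, M \in x :: s & all (<= M) (x :: s).
Proof.
elim: s x => [|a s IH] x; first by exists x; rewrite ?mem_head//= lexx.
have [M Ms sM] := IH a; have [xM|Mx] := leP x M.
  by exists M; [rewrite inE Ms orbT|rewrite /= xM].
exists x; first by rewrite mem_head.
rewrite /= lexx; apply: sub_all sM => y /=.
by move/le_trans; apply; exact: ltW.
Qed.

(** Cyclic monotonicity: skipping the largest point of a cycle does not
    decrease its gain, and the cycle reduced to one point has gain zero. *)
Lemma chain_sum_cycle x s : chain_sum x s x <= 0.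
Proof.
have [n] := ubnP (size s); elim: n s x => // n IH s x sn.
have [M] := exists_max x s; rewrite in_cons => /predU1P[-> /=/andP[_]|].
  case: s sn => [|z s] /= sn; first by rewrite k_diag.
  move=> /andP[zx sx]; rewrite addrC.
  have /= := @chain_sum_bypass z s x z; rewrite zx sx => /(_ isT isT) /le_trans.
  by apply; apply: IH; rewrite ltnS in sn.
move=> Ms; case: (splitPr Ms) sn => s1 s2; rewrite size_cat/= addnS ltnS => sn.
rewrite all_cat => /and3P[xM s1M /= /andP[_ s2M]].
have xs1M : all (<= M) (x :: s1) by rewrite /= xM.
apply: le_trans (IH (s1 ++ s2) x _); last by rewrite size_cat.
rewrite chain_sum_cat; case: s2 s2M {sn Ms} => [|z s2] /=.
  by rewrite cats0 => _; exact: chain_sum_bypass.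
move=> /andP[zM _]; rewrite chain_sum_cat addrA lerD2r.
exact: chain_sum_bypass.
Qed.

Hypothesis k_axis : forall x, k (x, 0) = 0.

Let chains (x : R) : set R := [set chain_sum x s 0 | s in [set s | all (>= 0) s]].

(** The potential of the theory of optimal transport, a supremum over paths to
    the origin, but restricted to paths through nonnegative points.  When
    [k] vanishes on the horizontal axis the restriction makes it monotone, hence
    measurable, whereas a supremum over all paths need not be. *)
Definition half_potential x : R := sup (chains x).

(* Closing a path into a cycle bounds its gain. *)
Let chains_ubound x : ubound (chains x) (- k (0, x)).
Proof.
move=> _ [s _ <-]; rewrite -subr_le0 opprK.
have -> : chain_sum x s 0 + k (0, x) = chain_sum x (s ++ [:: 0]) x.
  by rewrite chain_sum_cat.
exact: chain_sum_cycle.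
Qed.

Let chains_has_sup x : has_sup (chains x).
Proof. by split; [exists (k (x, 0)), [::]|exists (- k (0, x))]. Qed.

(** The exchange inequality between the heights [0] and [y], the former
    contributing nothing. *)
Lemma supermodular_ge0_homo x x' y : 0 <= y -> x <= x' -> k (x, y) <= k (x', y).
Proof. by move=> y0 xx'; have := k_super xx' y0; rewrite !k_axis addr0 add0r. Qed.

Lemma half_potential_homo : {homo half_potential : x y / x <= y}.
Proof.
move=> x y xy; apply: ge_sup => [|_ [s s0 <-]].
  by have [] := chains_has_sup x.
apply: (@le_trans _ _ (chain_sum y s 0)).
  case: s s0 => [|z s] /=; first by rewrite !k_axis.
  by move=> /andP[z0 _]; rewrite lerD2r supermodular_ge0_homo.
by apply: ub_le_sup; [have [] := chains_has_sup y|exists s].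
Qed.

Lemma half_potentialP x y : 0 <= y -> k (x, y) + half_potential y <= half_potential x.
Proof.
move=> y0; rewrite -lerBrDl; apply: ge_sup => [|_ [s s0 <-]].
  by have [] := chains_has_sup y.
rewrite lerBrDl; apply: ub_le_sup; first by have [] := chains_has_sup x.
by exists (y :: s) => //=; rewrite y0.
Qed.

Lemma half_potential0 : half_potential 0 = 0.
Proof.
apply/eqP; rewrite eq_le; apply/andP; split.
  apply: ge_sup => [|u u0]; first by have [] := chains_has_sup 0.
  by have := chains_ubound u0; rewrite k_diag oppr0.
apply: ub_le_sup; first by have [] := chains_has_sup 0.
by exists [::] => //=; rewrite k_diag.
Qed.

End chains.

(** * A measurable potential for a supermodular function *)

Section potential.
Context (R : realType).
Local Open Scope ring_scope.

Lemma supermodular_subr_marginals (k : R * R -> R) (a b : R -> R) :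
  supermodular k -> supermodular (fun z => k z - a z.1 - b z.2).
Proof.
move=> sk x1 x2 y1 y2 x12 y12 /=; have := sk _ _ _ _ x12 y12; lra.
Qed.

Lemma supermodular_opp_args (k : R * R -> R) :
  supermodular k -> supermodular (fun z => k (- z.1, - z.2)).
Proof.
move=> sk x1 x2 y1 y2 x12 y12 /=.
have := sk (- x2) (- x1) (- y2) (- y1); rewrite !lerN2 => /(_ x12 y12); lra.
Qed.

(** The two half-lines are treated separately, the negative one by reflection.
    They are glued by means of [k(x, y) <= k(x, 0) + k(0, y)], which holds
    when the origin lies between [x] and [y]. *)
Lemma normalized_potential (k : R * R -> R) :
    supermodular k -> (forall x, k (x, x) = 0) -> (forall x, k (x, 0) = 0) ->
  exists g : R -> R, measurable_fun [set: R] g /\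
    forall x y, k (x, y) <= g x - g y.
Proof.
move=> sk kd ka.
pose k' z := k (- z.1, - z.2).
have sk' : supermodular k' by exact: supermodular_opp_args.
have kd' x : k' (x, x) = 0 by rewrite /k' kd.
have ka' x : k' (x, 0) = 0 by rewrite /k' /= oppr0 ka.
pose gp := half_potential k; pose gm := half_potential k'.
have mgp : measurable_fun [set: R] gp.
  by apply: nondecreasing_measurable => //; exact: half_potential_homo.
have mgm : measurable_fun [set: R] gm.
  by apply: nondecreasing_measurable => //; exact: half_potential_homo.
pose g (x : R) : R := gp (Num.max x 0) + gm (Num.max (- x) 0).
exists g; split.
  apply: measurable_funD; apply: (measurableT_comp _) => //.
  - exact: measurable_maxr.
  - by apply: measurable_maxr => //; exact: measurableT_comp.
move=> x y; rewrite /g.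
have kp (u v : R) : 0 <= v -> k (u, v) <= gp u - gp v.
  by move=> v0; rewrite lerBrDr; exact: half_potentialP.
have km (u v : R) : v <= 0 -> k (u, v) <= gm (- u) - gm (- v).
  move=> v0; have := half_potentialP sk' kd' (- u) (y := - v).
  by rewrite oppr_ge0 /k'/= !opprK lerBrDr; exact.
have gp0 : gp 0 = 0 by exact: half_potential0.
have gm0 : gm 0 = 0 by exact: half_potential0.
have posE (u : R) : 0 <= u -> Num.max u 0 = u /\ Num.max (- u) 0 = 0.
  by move=> u0; rewrite max_l// max_r// oppr_le0.
have negE (u : R) : u <= 0 -> Num.max u 0 = 0 /\ Num.max (- u) 0 = - u.
  by move=> u0; rewrite max_r// max_l// oppr_ge0.
have [y0|y0] := orP (le_total 0 y); have [x0|x0] := orP (le_total 0 x).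
- have [-> ->] := posE _ x0; have [-> ->] := posE _ y0.
  by rewrite gm0 !addr0; exact: kp.
- have [-> ->] := negE _ x0; have [-> ->] := posE _ y0.
  have := sk _ _ _ _ x0 y0; have := kp 0 y y0; have := km x 0 (lexx _).
  by rewrite !ka oppr0 gp0 gm0; lra.
- have [-> ->] := posE _ x0; have [-> ->] := negE _ y0.
  have := sk _ _ _ _ x0 y0; have := kp x 0 (lexx _); have := km 0 y y0.
  by rewrite !ka oppr0 gp0 gm0; lra.
- have [-> ->] := negE _ x0; have [-> ->] := negE _ y0.
  by rewrite gp0 !add0r; apply: km.
Qed.

(** Subtracting functions of [x] and of [y] preserves supermodularity.  The
    subtraction below makes [k] vanish on the diagonal and on the horizontal
    axis; what it adds to the potential is the function [k(., 0)]. *)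
Lemma supermodular_potential (k : R * R -> R) :
    measurable_fun [set: R * R] k -> supermodular k ->
  exists g : R -> R, measurable_fun [set: R] g /\
    forall x y, k (x, y) - k (y, y) <= g x - g y.
Proof.
move=> mk sk.
pose k1 z := k z - k (z.1, 0) - (k (z.2, z.2) - k (z.2, 0)).
have [||| g1 [mg1 g1P]] := @normalized_potential k1.
- exact: (supermodular_subr_marginals (fun x => k (x, 0))
    (fun y => k (y, y) - k (y, 0)) sk).
- by move=> x; rewrite /k1/=; lra.
- by move=> x; rewrite /k1/=; lra.
exists (fun x => g1 x + k (x, 0)); split.
  by apply: measurable_funD => //; apply: measurableT_comp => //; exact: measurable_fun_pair.
by move=> x y; have := g1P x y; rewrite /k1/=; lra.
Qed.

End potential.

(** * Equality in law and the coupling inequality *)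

Section equal_laws.
Context d1 d2 d (T1 : measurableType d1) (T2 : measurableType d2)
  (Y : measurableType d) (R : realType).
Context (m1 : {measure set T1 -> \bar R}) (m2 : {measure set T2 -> \bar R}).
Context (X1 : T1 -> Y) (X2 : T2 -> Y).
Hypotheses (mX1 : measurable_fun [set: T1] X1) (mX2 : measurable_fun [set: T2] X2).
Hypothesis law_eq : forall A, measurable A -> m1 (X1 @^-1` A) = m2 (X2 @^-1` A).

Lemma ge0_integral_eq_law (f : Y -> \bar R) :
    measurable_fun [set: Y] f -> (forall y, 0 <= f y) ->
  \int[m1]_w f (X1 w) = \int[m2]_w f (X2 w).
Proof.
move=> mf f0.
transitivity (\int[pushforward m1 X1]_y f y).
  by rewrite ge0_integral_pushforward.
transitivity (\int[pushforward m2 X2]_y f y).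
  by apply: eq_measure_integral => A mA _; exact: law_eq.
by rewrite ge0_integral_pushforward.
Qed.

Lemma integral_eq_law (f : Y -> \bar R) : measurable_fun [set: Y] f ->
  \int[m1]_w f (X1 w) = \int[m2]_w f (X2 w).
Proof.
move=> mf; rewrite integralE [RHS]integralE.
congr (_ - _).
- rewrite (funepos_comp f X1) (funepos_comp f X2).
  by apply: ge0_integral_eq_law => //; exact: measurable_funepos.
- rewrite (funeneg_comp f X1) (funeneg_comp f X2).
  by apply: ge0_integral_eq_law => //; exact: measurable_funeneg.
Qed.

Lemma integrable_eq_law (f : Y -> \bar R) : measurable_fun [set: Y] f ->
  m1.-integrable [set: T1] (fun w => f (X1 w)) ->
  m2.-integrable [set: T2] (fun w => f (X2 w)).
Proof.
move=> mf /integrableP[_ foo]; apply/integrableP; split.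
  exact: measurableT_comp.
rewrite -(@ge0_integral_eq_law (fun y => `|f y|))//.
exact: measurableT_comp.
Qed.

End equal_laws.

Lemma integrable_subr d (T : measurableType d) (R : realType)
    (m : {measure set T -> \bar R}) (f g : T -> R) :
  m.-integrable [set: T] (EFin \o f) -> m.-integrable [set: T] (EFin \o g) ->
  m.-integrable [set: T] (EFin \o (fun w => f w - g w)%R).
Proof. by move=> mf mg; exact: (integrableB measurableT mf mg). Qed.

Section same_marginals.
Context d (T : measurableType d) (R : realType) (P : probability T R).
Context (U V : T -> R).
Hypotheses (mU : measurable_fun [set: T] U) (mV : measurable_fun [set: T] V).
Hypothesis law_eq : forall A, measurable A -> P (U @^-1` A) = P (V @^-1` A).

Let clamp (n : nat) (x : R) : R := Num.max (- n%:R)%R (Num.min (n%:R)%R x).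

Let clampE n x : (`|x| <= n%:R)%R -> clamp n x = x.
Proof. by rewrite ler_norml => /andP[nx xn]; rewrite /clamp min_r// max_r. Qed.

Let norm_clamp n x : (`|clamp n x| <= n%:R)%R.
Proof.
rewrite ler_norml /clamp le_max lexx /= ge_max ge_min lexx /= andbT.
by rewrite (le_trans _ (ler0n _ n))// oppr_le0.
Qed.

Let clamp_diff n x y : (Num.min 0 (x - y) <= clamp n x - clamp n y)%R.
Proof.
rewrite /clamp; set N : R := n%:R%R; have N0 : (0 <= N)%R by exact: ler0n.
case: (leP N x) => ?; case: (leP N y) => ?; case: (leP (- N)%R x) => ?;
  case: (leP (- N)%R y) => ?; case: (leP (- N)%R N) => ?;
  case: (leP 0%R (x - y)%R) => ?; lra.
Qed.

Let measurable_clamp (g : R -> R) n : measurable_fun [set: R] g ->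
  measurable_fun [set: R] (fun x => clamp n (g x)).
Proof.
move=> mg.
apply: (@measurable_maxr _ _ _ _ (cst _) (fun x => Num.min n%:R%R (g x))) => //.
exact: (@measurable_minr _ _ _ _ (cst _) g).
Qed.

Let integrable_clamp (g : R -> R) (W : T -> R) n : measurable_fun [set: R] g ->
  measurable_fun [set: T] W ->
  P.-integrable [set: T] (EFin \o (fun w => clamp n (g (W w)))).
Proof.
move=> mg mW; apply: (@le_integrable _ _ _ _ _ measurableT _ (EFin \o cst n%:R)).
- apply/measurable_EFinP; exact: (measurableT_comp (measurable_clamp n mg) mW).
- by move=> w _ /=; rewrite lee_fin [leRHS]ger0_norm ?norm_clamp.
- exact: finite_measure_integrable_cst.
Qed.

(** If [g(U)] were integrable the bound would be immediate, its expectation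
    being that of [g(V)].  In general [g] is clamped to [[-n, n]].  The minimum
    of [D] and of the clamped difference is dominated by [|D|], because clamping
    never makes a difference more negative, and it converges to [D]. *)
Lemma integral_le0_potential (D : T -> R) (g : R -> R) :
    measurable_fun [set: R] g -> P.-integrable [set: T] (EFin \o D) ->
    (forall w, D w <= g (U w) - g (V w))%R ->
  \int[P]_w (D w)%:E <= 0.
Proof.
move=> mg iD Dg.
have mD : measurable_fun [set: T] D by apply/measurable_EFinP; exact: measurable_int iD.
pose E n w := (clamp n (g (U w)) - clamp n (g (V w)))%R.
have iE n : P.-integrable [set: T] (EFin \o E n).
  by apply: integrable_subr; exact: integrable_clamp.
have mE n : measurable_fun [set: T] (E n).
  by apply/measurable_EFinP; exact: measurable_int (iE n).
have E0 n : \int[P]_w (E n w)%:E = 0.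
  rewrite integralB_EFin//; [|exact: integrable_clamp..].
  rewrite (integral_eq_law mU mV law_eq (f := fun x => (clamp n (g x))%:E)).
    by rewrite subee// integrable_fin_num//; exact: integrable_clamp.
  by apply/measurable_EFinP; exact: measurable_clamp.
pose F n w := (Num.min (D w) (E n w))%:E.
have mF n : measurable_fun [set: T] (F n).
  by apply/measurable_EFinP; exact: measurable_minr.
have FD n w : `|F n w| <= `|(D w)%:E|.
  rewrite /F/= lee_fin.
  have := clamp_diff n (g (U w)) (g (V w)); rewrite -/(E n w) ge_min.
  have := Dg w; rewrite ler_norml.
  have := ler_norm (D w); have := ler_norm (- D w)%R; rewrite normrN.
  have [] := leP (D w) (E n w) => ? ? ? ? /orP[] ?; apply/andP; split; lra.
have iF n : P.-integrable [set: T] (F n).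
  exact: (@le_integrable _ _ _ _ _ measurableT _ (EFin \o D)).
have [] := @dominated_convergence _ _ _ P _ measurableT F (EFin \o D)
  (fun w => `|(D w)%:E|) mF _ _ _ _.
- exact/measurable_EFinP.
- apply/aeW => w _.
  apply: (@cvg_near_cst _ _ _ _ _ _).
  near=> n; rewrite /F /E !clampE; [by rewrite min_l|..].
  + near: n; exact: nbhs_infty_ger.
  + near: n; exact: nbhs_infty_ger.
- exact: integrable_abse.
- by apply/aeW => w n _; exact: FD.
move=> _ _ cvF; rewrite -(cvg_lim _ cvF)//; apply: lime_le.
  by apply/cvg_ex; eexists; exact: cvF.
apply: nearW => n; rewrite -(E0 n); apply: le_integral => //.
- exact: iE.
- by move=> w _; rewrite lee_fin ge_min lexx orbT.
Unshelve. all: end_near.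
Qed.

(** The potential bounds the difference of the two integrands by [g(U) - g(V)],
    which has mean zero up to truncation.  In terms of transport, the diagonal
    coupling of a law with itself is optimal. *)
Theorem le_integral_supermodular (k : R * R -> R) :
    measurable_fun [set: R * R] k -> supermodular k ->
    P.-integrable [set: T] (fun w => (k (U w, V w))%:E) ->
    P.-integrable [set: T] (fun w => (k (V w, V w))%:E) ->
  \int[P]_w (k (U w, V w))%:E <= \int[P]_w (k (V w, V w))%:E.
Proof.
move=> mk sk iUV iVV.
have [g [mg kg]] := supermodular_potential mk sk.
rewrite -sube_le0 -integralB_EFin//.
apply: (integral_le0_potential (g := g)) => //.
exact: integrable_subr.
Qed.

End same_marginals.

(** * Monotone sampling of a stochastically monotone kernel *)

Section quantile.
Context (R : realType).

(** The generalized inverse of a tail function. *)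
Definition upper_quantile (S : R -> \bar R) (u : R) : R :=
  sup [set z | u%:E < S z].

Section quantile_of_probability.
Context (mu : probability R R).

Let id_fun : R -> R := idfun.

#[local] HB.instance Definition _ :=
  @isMeasurableFun.Build _ _ _ _ id_fun (@measurable_id _ _ setT).

Let X : {RV mu >-> R} := id_fun.

Let tail (z : R) : \bar R := mu `]z, +oo[%classic.

Let tailE : tail = ccdf X. Proof. by []. Qed.

(** The strict form of the Galois connection between a tail and its quantile.
    It rests on the right continuity of the tail, and on its limits for the
    supremum to be proper. *)
Lemma upper_quantile_gt (u z : R) : (0 < u < 1)%R ->
  (z < upper_quantile tail u)%R = (u%:E < tail z).
Proof.
move=> /andP[u0 u1]; rewrite /upper_quantile; set A := [set z | _].
have tail_noninc : nonincreasing_fun tail by rewrite tailE; exact: ccdf_nonincreasing.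
have A_sup : has_sup A.
  split.
    have /filter_ex[a ua] : \forall a \near -oo%R, u%:E < ccdf X a.
      have h := @cvg_ccdfNy1 _ _ _ _ X.
      apply: (h [set y | u%:E < y]); apply: open_nbhs_nbhs.
      by split; [exact: open_ereal_gt_ereal|rewrite /= lte_fin].
    by exists a.
  have /filter_ex[b bu] : \forall b \near +oo%R, ccdf X b < u%:E.
    have h := @cvg_ccdfy0 _ _ _ _ X.
    apply: (h [set y | y < u%:E]); apply: open_nbhs_nbhs.
    by split; [exact: open_ereal_lt_ereal|rewrite /= lte_fin].
  exists b => c; rewrite /A/= => uc; rewrite leNgt; apply/negP => bc.
  have := lt_trans uc (le_lt_trans (tail_noninc _ _ (ltW bc)) bu).
  by rewrite ltxx.
apply/idP/idP => [zA|uz].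
  have [|a Aa /ltW za] := sup_gt _ zA; first by case: A_sup.
  by apply: lt_le_trans Aa _; exact: tail_noninc.
have near_z : \forall a \near z^'+, (u%:E < tail a) && (z < a)%R.
  near=> a; apply/andP; split; last by near: a; exact: nbhs_right_gt.
  near: a; have h := @ccdf_right_continuous _ _ _ _ X z.
  apply: (h [set y | u%:E < y]); apply: open_nbhs_nbhs.
  by split; [exact: open_ereal_gt_ereal|].
have [a] := @filter_ex _ _ (at_right_proper_filter z) _ near_z.
move=> /andP[ua za].
by apply: (lt_le_trans za); apply: ub_le_sup => //; case: A_sup.
Unshelve. all: by end_near.
Qed.

End quantile_of_probability.
End quantile.

(** Naming this family of measures allows each of them to be declared a
    probability, which the results on tails require. *)
Definition kernel_law (R : realType) (p : R.-pker R ~> R) (x : R) :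
  set R -> \bar R := p x.

Section kernel_law_probability.
Context (R : realType) (p : R.-pker R ~> R) (x : R).

HB.instance Definition _ := isMeasure.Build _ _ _ (kernel_law p x)
  (measure0 (p x)) (measure_ge0 (p x)) (@measure_semi_sigma_additive _ _ _ (p x)).

HB.instance Definition _ :=
  Measure_isProbability.Build _ _ _ (kernel_law p x) (prob_kernel x).

End kernel_law_probability.

Section sampler.
Context (R : realType) (p : R.-pker R ~> R).

Definition noise : probability (measurableTypeR R) R := uniform_prob (@ltr01 R).

(** Outside the open unit interval, a null set for the noise, the quantile is
    not proper; a constant value keeps the sampler monotone there. *)
Definition sampler (xu : R * measurableTypeR R) : R :=
  if (0 < xu.2 < 1)%R then upper_quantile (fun z => p xu.1 `]z, +oo[%classic) xu.2
  else 0%R.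

Lemma sampler_gt x u z : (z < sampler (x, u))%R =
  if (0 < u < 1)%R then u%:E < p x `]z, +oo[%classic else (z < 0)%R.
Proof.
by rewrite /sampler/=; case: ifPn => // u01; rewrite (upper_quantile_gt (kernel_law p x)).
Qed.

Lemma measurable_sampler : measurable_fun [set: R * measurableTypeR R] sampler.
Proof.
apply: (measurability _ (RGenOInfty.measurableE R)) => // _ [_ [z ->] <-].
rewrite setTI.
pose b (xu : R * measurableTypeR R) : bool :=
  if (0 < xu.2 < 1)%R then xu.2%:E < p xu.1 `]z, +oo[%classic else (z < 0)%R.
rewrite (_ : _ @^-1` _ = b @^-1` [set true]).
  suff mb : measurable_fun setT b by rewrite -[X in measurable X]setTI; exact: mb.
  apply: measurable_fun_ifT => //.
  - apply: measurable_and.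
    + by apply: measurable_fun_ltr => //; exact: measurable_snd.
    + by apply: measurable_fun_ltr => //; exact: measurable_snd.
  - apply: measurable_fun_lte.
      by apply/measurable_EFinP; exact: measurable_snd.
    have mp := measurable_kernel p `]z, +oo[%classic (measurable_itv _).
    exact: (measurableT_comp mp measurable_fst).
by apply/seteqP; split => -[x u]; rewrite /= in_itv/= andbT sampler_gt.
Qed.

Let noise_lt (s : R) : (0 <= s <= 1)%R -> noise `]0%R, s[%classic = s%:E.
Proof.
move=> /andP[s0 s1]; rewrite /noise/= /uniform_prob.
rewrite (eq_integral (cst 1)); last first.
  move=> u; rewrite inE/= in_itv/= => /andP[u0 us]; rewrite /uniform_pdf.
  by rewrite (ltW u0) (ltW (lt_le_trans us s1)) subr0 invr1.
rewrite integral_cst//= mul1e lebesgue_measure_itv/= lte_fin.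
by case: ltgtP s0 => // [s0|<-] _; rewrite ?oppr0 ?adde0 ?subr0.
Qed.

(* The noise lives on the open unit interval: the value given to the sampler
   elsewhere has no influence on its law. *)
Let noise01 (A : set (measurableTypeR R)) : measurable A ->
  noise A = noise (A `&` `]0%R, 1%R[%classic).
Proof.
move=> mA; have mI : measurable (`]0%R, 1%R[%classic : set (measurableTypeR R)) by [].
rewrite (measureDI noise mA mI) [X in X + _](_ : _ = 0) ?add0e//.
apply/eqP; rewrite -measure_le0.
apply: (@le_trans _ _ (noise (~` `]0%R, 1%R[%classic))).
  by apply: le_measure; rewrite ?inE; [exact: measurableD|exact: measurableC|];
    move=> u [].
by rewrite probability_setC// noise_lt ?ler01 ?lexx// subee.
Qed.

Lemma noise_sampler x A : measurable A ->
  p x A = noise [set u | A (sampler (x, u))].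
Proof.
move=> mA; rewrite -[RHS]/(pushforward noise (fun u => sampler (x, u)) A).
have ms : measurable_fun [set: measurableTypeR R] (fun u => sampler (x, u)).
  exact: measurable_fun_pair2 measurable_sampler.
apply: (measure_unique (@RGenOInfty.G R) (fun n => `](- n%:R)%R, +oo[%classic)) => //.
- exact: RGenOInfty.measurableE.
- move=> _ _ [a ->] [b ->]; exists (Num.max a b).
  by apply/seteqP; split => z /=; rewrite !in_itv/= !andbT gt_max => /andP.
- by move=> n; exists (- n%:R)%R.
- rewrite -subTset => z _; exists (Num.bound z) => //=.
  by rewrite in_itv/= andbT ltrNl unstable.ltrNbound.
- move=> _ [z ->]; rewrite /= /pushforward noise01; last first.
    rewrite -[X in measurable X]setTI; exact: ms.
  have p1 : p x `]z, +oo[%classic <= 1.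
    by rewrite -(prob_kernel (s := p) x); apply: le_measure; rewrite ?inE.
  have pfin : p x `]z, +oo[%classic \is a fin_num.
    by rewrite ge0_fin_numE// (le_lt_trans p1) ?ltry.
  rewrite (_ : _ `&` _ = `]0%R, fine (p x `]z, +oo[%classic)[%classic).
    by rewrite noise_lt ?fineK// fine_ge0//= -lee_fin fineK.
  apply/seteqP; split => u /=; rewrite !in_itv/= andbT sampler_gt.
    move=> [+ u01]; rewrite u01 -[in X in X -> _](fineK pfin) lte_fin => ->.
    by case/andP: u01 => ->.
  move=> /andP[u0 us].
  have u1 : (u < 1)%R by apply: (lt_le_trans us); rewrite -lee_fin fineK.
  by rewrite u0 u1/= -(fineK pfin) lte_fin.
- by move=> n; rewrite (le_lt_trans _ (ltry 1))//= -(prob_kernel (s := p) x);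
    apply: le_measure; rewrite ?inE.
Qed.

Hypothesis p_mono : stochastically_monotone p.

Lemma sampler_homo u : {homo (fun x => sampler (x, u)) : x y / (x <= y)%R}.
Proof.
move=> x y xy; rewrite leNgt; apply/negP => yx.
have := yx; rewrite sampler_gt; case: ifPn => u01 h.
  have := lt_le_trans h (p_mono (sampler (y, u)) xy).
  by have := sampler_gt y u (sampler (y, u)); rewrite u01 ltxx => <-.
by move: h; rewrite /sampler (negbTE u01) ltxx.
Qed.

End sampler.

(** * Association of monotone functions *)

Section association.
Context d (T : measurableType d) (R : realType) (P : probability T R).

Lemma supermodular_mul (f g : R -> R) :
  {homo f : x y / (x <= y)%R} -> {homo g : x y / (x <= y)%R} ->
  supermodular (fun z => f z.1 * g z.2)%R.
Proof.
move=> f_homo g_homo x1 x2 y1 y2 /f_homo fx /g_homo gy /=.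
by rewrite -subr_ge0 (_ : _ - _ = (f x2 - f x1) * (g y2 - g y1))%R;
  [apply: mulr_ge0; rewrite subr_ge0|ring].
Qed.

(** On two independent copies of [T] the projections give variables [U2] and [V2]
    with the law of [V].  Independence turns [E f(U2) g(V2)] into the product of
    the expectations, and the diagonal coupling dominates it. *)
Lemma integral_mul_homo_ge (V : T -> R) (f g : R -> R) :
    measurable_fun [set: T] V ->
    {homo f : x y / (x <= y)%R} -> {homo g : x y / (x <= y)%R} ->
    P.-integrable [set: T] (fun w => (f (V w))%:E) ->
    P.-integrable [set: T] (fun w => (g (V w))%:E) ->
    P.-integrable [set: T] (fun w => (f (V w) * g (V w))%:E) ->
  (\int[P]_w (f (V w))%:E) * (\int[P]_w (g (V w))%:E) <=
  \int[P]_w (f (V w) * g (V w))%:E.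
Proof.
move=> mV f_homo g_homo intf intg intfg.
have mf : measurable_fun [set: R] f by exact: nondecreasing_measurable.
have mg : measurable_fun [set: R] g by exact: nondecreasing_measurable.
have mfV : measurable_fun [set: T] (fun w => f (V w)) by exact: measurableT_comp.
have mgV : measurable_fun [set: T] (fun w => g (V w)) by exact: measurableT_comp.
have fing := integrable_fin_num measurableT intg.
pose U2 (w : T * T) := V w.1; pose V2 (w : T * T) := V w.2.
have mU2 : measurable_fun [set: T * T] U2 by exact: measurableT_comp mV measurable_fst.
have mV2 : measurable_fun [set: T * T] V2 by exact: measurableT_comp mV measurable_snd.
have lawU2 A : measurable A -> (P \x P) (U2 @^-1` A) = P (V @^-1` A).
  move=> mA.
  have mVA : measurable (V @^-1` A) by rewrite -[X in measurable X]setTI; exact: mV.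
  rewrite (_ : U2 @^-1` A = (V @^-1` A) `*` setT).
    by rewrite product_measure1E// -[RHS]mule1; congr (_ * _); exact: probability_setT.
  by apply/seteqP; split => [w|w []].
have lawV2 A : measurable A -> (P \x P) (V2 @^-1` A) = P (V @^-1` A).
  move=> mA.
  have mVA : measurable (V @^-1` A) by rewrite -[X in measurable X]setTI; exact: mV.
  rewrite (_ : V2 @^-1` A = setT `*` (V @^-1` A)).
    by rewrite product_measure1E// -[RHS]mul1e; congr (_ * _); exact: probability_setT.
  by apply/seteqP; split => [w|w []].
have mfg : measurable_fun [set: R] (fun x => (f x * g x)%:E).
  by apply/measurable_EFinP; exact: measurable_funM.
have mk : measurable_fun [set: R * R] (fun z => f z.1 * g z.2)%R.
  by apply: measurable_funM; exact: measurableT_comp.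
have mF : measurable_fun [set: T * T] (fun w => (f (U2 w) * g (V2 w))%:E).
  by apply/measurable_EFinP; apply: measurable_funM; exact: measurableT_comp.
have int2 : (P \x P).-integrable [set: T * T] (fun w => (f (U2 w) * g (V2 w))%:E).
  apply/integrable12ltyP => //.
  rewrite (eq_integral (fun x => `|(f (V x))%:E| * \int[P]_y `|(g (V y))%:E|)).
    rewrite ge0_integralZr//; [|exact/measurable_EFinP/measurableT_comp|exact: integral_ge0].
    have [/integrableP[_ foo] /integrableP[_ goo]] := (intf, intg).
    by apply: lte_mul_pinfty => //; rewrite ?ge0_fin_numE//; exact: integral_ge0.
  move=> x _; rewrite -ge0_integralZl//; last first.
    by apply: measurableT_comp => //; exact/measurable_EFinP.
  by apply: eq_integral => y _; rewrite -abseM.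
have int1 : (P \x P).-integrable [set: T * T] (fun w => (f (V2 w) * g (V2 w))%:E).
  by apply: (integrable_eq_law (m1 := P) mV mV2 _ mfg) => // A mA; exact/esym/lawV2.
have := @le_integral_supermodular _ _ _ (P \x P) U2 V2 mU2 mV2 _ _ mk
  (supermodular_mul f_homo g_homo) int2 int1.
rewrite /= (integral_eq_law mV2 mV lawV2 mfg).
rewrite -(integral12_prod_meas1 int2) /fubini_F /=.
move=> H; apply: le_trans (H _); last first.
  by move=> A mA; exact: etrans (lawU2 A mA) (esym (lawV2 A mA)).
rewrite [leRHS](eq_integral (fun x => (f (V x))%:E * \int[P]_y (g (V y))%:E)).
  by rewrite -(fineK fing) integralZr// lexx.
move=> x _.
by rewrite -integralZl//; apply: eq_integral => y _; rewrite EFinM.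
Qed.

End association.

(** * Joint laws through the sampler *)

Section conditional_law.
Context d d' (T : measurableType d) (T' : measurableType d') (R : realType).
Context (P : probability T R) (p : R.-pker R ~> R).
Context (W : T -> T') (V Z : T -> R).
Hypotheses (mW : measurable_fun [set: T] W) (mV : measurable_fun [set: T] V)
  (mZ : measurable_fun [set: T] Z).

(** What the joint law of [W] and [Z] retains of the statement that [p V] is the
    conditional law of [Z] given [W] and [V].  When [W] is [V] it is the full
    statement that [p V] is the conditional law of [Z] given [V]. *)
Definition cond_law := forall A B, measurable A -> measurable B ->
  \int[P]_(w in W @^-1` B) p (V w) A = P (Z @^-1` A `&` W @^-1` B).

Hypothesis condZ : cond_law.

Let resample (wu : T * measurableTypeR R) : T' * R := (W wu.1, sampler p (V wu.1, wu.2)).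

Lemma measurable_sampler_comp :
  measurable_fun [set: T * measurableTypeR R] (fun wu => sampler p (V wu.1, wu.2)).
Proof.
apply: (measurableT_comp (@measurable_sampler _ p)).
apply: measurable_fun_pair; last exact: measurable_snd.
exact: measurableT_comp mV measurable_fst.
Qed.

Lemma measurable_resample : measurable_fun [set: T * measurableTypeR R] resample.
Proof.
apply: measurable_fun_pair; last exact: measurable_sampler_comp.
exact: measurableT_comp mW measurable_fst.
Qed.

(** On rectangles the two laws agree, by the hypothesis on [Z] on one side and by
    [noise_sampler] on the other.  In expectations that involve only [W] and [Z],
    a fresh sample of [p V] thus stands for [Z]. *)
Lemma joint_law_sampler C : measurable C ->
  P ((fun w => (W w, Z w)) @^-1` C) = (P \x noise R) (resample @^-1` C).
Proof.
have mres := measurable_resample.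
have mWZ : measurable_fun [set: T] (fun w => (W w, Z w)) by exact: measurable_fun_pair.
move=> mC; rewrite -[LHS]/(pushforward P (fun w => (W w, Z w)) C).
rewrite -[RHS]/(pushforward (P \x noise R) resample C).
pose G := [set B `*` A | B in @measurable _ T' & A in @measurable _ R].
apply: (measure_unique G (fun=> setT)) => //.
- by rewrite measurable_prod_measurableType.
- move=> _ _ [B1 mB1 [A1 mA1 <-]] [B2 mB2 [A2 mA2 <-]].
  exists (B1 `&` B2); first exact: measurableI.
  by exists (A1 `&` A2); [exact: measurableI|rewrite setXI].
- by move=> _; exists setT => //; exists setT => //; rewrite setXTT.
- by rewrite bigcup_const.
- move=> _ [B mB [A mA <-]].
  rewrite /pushforward /= -[LHS]/(P _).
  rewrite (_ : _ @^-1` _ = Z @^-1` A `&` W @^-1` B); last first.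
    by apply/seteqP; split => w [].
  rewrite -condZ// integral_mkcond; apply: eq_integral => w _.
  rewrite patchE /= xsectionE /=; case: ifPn => wB.
    rewrite noise_sampler//; congr (noise R _); apply/seteqP; split => u //=.
      by split => //; rewrite inE in wB.
    by case.
  rewrite (_ : _ @^-1` _ = set0) ?measure0//.
  by apply/seteqP; split => u // []/= WB _; rewrite notin_setE in wB; exact: wB.
- by move=> _; rewrite /= -[X in X < _]/(P _) preimage_setT probability_setT ltry.
Qed.

End conditional_law.

Section kernel_integral.
Context (R : realType) (p : R.-pker R ~> R).

Lemma integral_sampler (f : R -> \bar R) x :
    measurable_fun [set: R] f -> (forall y, 0 <= f y) ->
  \int[p x]_y f y = \int[noise R]_u f (sampler p (x, u)).
Proof.
move=> mf f0; apply: (@ge0_integral_eq_law _ _ _ _ _ _ _ (p x) (noise R) id) => //.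
  exact: measurable_fun_pair2 (@measurable_sampler _ p).
by move=> A mA; exact: noise_sampler.
Qed.

End kernel_integral.

(** * Comparison of couplings through a monotone kernel *)

Section fibrewise.
Context d1 d2 (T1 : measurableType d1) (T2 : measurableType d2) (R : realType).
Context (m1 : {sigma_finite_measure set T1 -> \bar R})
  (m2 : {sigma_finite_measure set T2 -> \bar R}).

(** The form in which Fubini's theorem turns inequalities at almost every frozen
    value of the noise into inequalities between expectations. *)
Lemma integral_fibre_ge0 (D : T1 * T2 -> \bar R) :
    (m1 \x m2).-integrable [set: T1 * T2] D ->
    {ae m2, forall y, 0 <= \int[m1]_x D (x, y)} ->
  0 <= \int[m1 \x m2]_z D z.
Proof.
move=> iD D0; rewrite -(integral21_prod_meas1 iD).
have mG := measurable_fubini_G iD.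
rewrite (ae_eq_integral (fun y => `|fubini_G m1 D y|)) => //.
- exact: integral_ge0.
- exact: measurableT_comp.
- by apply: filterS D0 => y D0 _; rewrite gee0_abs.
Qed.

End fibrewise.

Section monotone_coupling.
Context d (T : measurableType d) (R : realType) (P : probability T R).
Context (p : R.-pker R ~> R) (V Z : T -> R).
Hypotheses (mV : measurable_fun [set: T] V) (mZ : measurable_fun [set: T] Z).
Hypotheses (p_mono : stochastically_monotone p) (condV : cond_law P p V V Z).

Let S (wu : T * measurableTypeR R) : R := sampler p (V wu.1, wu.2).

Let mS : measurable_fun [set: T * measurableTypeR R] S.
Proof. exact: measurable_sampler_comp. Qed.

(** For almost every value [u] of the noise the coupling inequality applies to
    [h(x, q(y, u))], which is supermodular because [q(., u)] is monotone. *)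
Theorem le_integral_supermodular_kernel (U : T -> R) (h : R * R -> R) :
    measurable_fun [set: T] U ->
    (forall A, measurable A -> P (U @^-1` A) = P (V @^-1` A)) ->
    cond_law P p U V Z ->
    measurable_fun [set: R * R] h -> supermodular h ->
    P.-integrable [set: T] (fun w => (h (U w, Z w))%:E) ->
    P.-integrable [set: T] (fun w => (h (V w, Z w))%:E) ->
  \int[P]_w (h (U w, Z w))%:E <= \int[P]_w (h (V w, Z w))%:E.
Proof.
move=> mU lawUV condU mh sh iU iV.
have mhE : measurable_fun [set: R * R] (EFin \o h) by exact/measurable_EFinP.
have mUZ : measurable_fun [set: T] (fun w => (U w, Z w)) by exact: measurable_fun_pair.
have mVZ : measurable_fun [set: T] (fun w => (V w, Z w)) by exact: measurable_fun_pair.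
have mUS := measurable_resample p mU mV.
have mVS := measurable_resample p mV mV.
have lawU := joint_law_sampler mU mV mZ condU.
have lawV := joint_law_sampler mV mV mZ condV.
have iUS := integrable_eq_law mUZ mUS lawU mhE iU.
have iVS := integrable_eq_law mVZ mVS lawV mhE iV.
rewrite (integral_eq_law mUZ mUS lawU mhE) (integral_eq_law mVZ mVS lawV mhE).
rewrite -sube_ge0; last by apply/orP; left; exact: (integrable_fin_num _ iUS).
rewrite -integralB//.
apply: integral_fibre_ge0; first exact: integrableB.
have := ae_integrable2 iVS; apply: filterS2 (ae_integrable2 iUS) => u iUu iVu.
rewrite [X in 0 <= X](integralB measurableT iVu iUu) sube_ge0; last first.
  by apply/orP; left; exact: (integrable_fin_num _ iUu).
pose hu z := h (z.1, sampler p (z.2, u)).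
apply: (@le_integral_supermodular _ _ _ P U V mU mV lawUV hu) => //.
- apply: measurableT_comp mh _; apply: measurable_fun_pair; first exact: measurable_fst.
  apply: (measurableT_comp (measurable_fun_pair1 _ (@measurable_sampler _ p))).
  exact: measurable_snd.
- by move=> x1 x2 y1 y2 x12 y12; apply: sh => //; exact: sampler_homo.
Qed.

(** At a frozen value [u] of the noise [g(q(., u))] is nondecreasing, so the
    association inequality applies to it and [f]. *)
Theorem integral_mul_homo_kernel_ge (f g : R -> R) :
    {homo f : x y / (x <= y)%R} -> {homo g : x y / (x <= y)%R} ->
    P.-integrable [set: T] (fun w => (f (V w))%:E) ->
    P.-integrable [set: T] (fun w => (g (Z w))%:E) ->
    P.-integrable [set: T] (fun w => (f (V w) * g (Z w))%:E) ->
  (\int[P]_w (f (V w))%:E) * (\int[P]_w (g (Z w))%:E) <=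
  \int[P]_w (f (V w) * g (Z w))%:E.
Proof.
move=> f_homo g_homo intf intg intfg.
have mf : measurable_fun [set: R] f by exact: nondecreasing_measurable.
have mg : measurable_fun [set: R] g by exact: nondecreasing_measurable.
have mVZ : measurable_fun [set: T] (fun w => (V w, Z w)) by exact: measurable_fun_pair.
have mVS := measurable_resample p mV mV.
have lawV := joint_law_sampler mV mV mZ condV.
have mfg : measurable_fun [set: R * R] (fun z => (f z.1 * g z.2)%:E).
  by apply/measurable_EFinP/measurable_funM; exact: measurableT_comp.
have mg2 : measurable_fun [set: R * R] (fun z => (g z.2)%:E).
  by apply/measurable_EFinP; exact: measurableT_comp.
have iS := integrable_eq_law mVZ mVS lawV mg2 intg.
have iVS := integrable_eq_law mVZ mVS lawV mfg intfg.
have fin_f := integrable_fin_num measurableT intf.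
set c := \int[P]_w (f (V w))%:E in fin_f *.
rewrite (integral_eq_law mVZ mVS lawV mg2) (integral_eq_law mVZ mVS lawV mfg).
rewrite -(fineK fin_f) -integralZl// -sube_ge0; last first.
  by apply/orP; left; apply: integrable_fin_num => //; exact: integrableZl.
have icS := integrableZl measurableT (fine c) iS.
rewrite -integralB//.
apply: integral_fibre_ge0; first exact: integrableB.
have := ae_integrable2 iVS; apply: filterS2 (ae_integrable2 iS) => u iSu iVSu.
have icSu := integrableZl measurableT (fine c) iSu.
rewrite [X in 0 <= X](integralB measurableT iVSu icSu) sube_ge0; last first.
  by apply/orP; left; exact: (integrable_fin_num _ icSu).
rewrite integralZl// fineK//.
apply: (@integral_mul_homo_ge _ _ _ P V f (fun v => g (sampler p (v, u)))) => //.
by move=> x y xy; apply/g_homo/sampler_homo.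
Qed.

End monotone_coupling.

Section kernel_composition.
Context d d' (T : measurableType d) (T' : measurableType d') (R : realType).
Context (P : probability T R) (W : T -> T') (V Y Z : T -> R).
Hypotheses (mW : measurable_fun [set: T] W) (mV : measurable_fun [set: T] V)
  (mY : measurable_fun [set: T] Y).

Lemma integral_cond_law (p : R.-pker R ~> R) (B : set T') (f : R -> \bar R) :
    cond_law P p W V Y -> measurable B ->
    measurable_fun [set: R] f -> (forall y, 0 <= f y) ->
  \int[P]_(w in W @^-1` B) f (Y w) = \int[P]_(w in W @^-1` B) \int[p (V w)]_y f y.
Proof.
move=> condY mB mf f0.
have mWY : measurable_fun [set: T] (fun w => (W w, Y w)) by exact: measurable_fun_pair.
have mWS := measurable_resample p mW mV.
have lawW := joint_law_sampler mW mV mY condY.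
pose F (z : T' * R) := if z.1 \in B then f z.2 else 0.
have mF : measurable_fun [set: T' * R] F.
  apply: measurable_fun_ifT => //; last exact: measurableT_comp mf measurable_snd.
  apply: (measurable_fun_bool true); rewrite setTI.
  rewrite (_ : _ @^-1` _ = B `*` setT); first exact: measurableX.
  by apply/seteqP; split => z /=; [move/set_mem|move=> [/mem_set]].
have F0 z : 0 <= F z by rewrite /F; case: ifP.
transitivity (\int[P]_w F (W w, Y w)).
  rewrite integral_mkcond; apply: eq_integral => w _.
  by rewrite patchE.
rewrite (ge0_integral_eq_law mWY mWS lawW mF F0).
rewrite fubini_tonelli1//; last exact: measurableT_comp mF mWS.
rewrite [RHS]integral_mkcond; apply: eq_integral => w _; rewrite patchE /fubini_F /F/=.
rewrite -[w \in W @^-1` B]/(W w \in B).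
by case: ifP => wB; [rewrite integral_sampler|rewrite integral0].
Qed.

Context (p q : R.-pker R ~> R).

Let comp_setT x : mkcomp_noparam p q x [set: R] = 1.
Proof.
rewrite /mkcomp_noparam/= /kcomp_noparam.
rewrite (eq_integral (cst 1)); last by move=> y _; rewrite prob_kernel.
by rewrite integral_cst// prob_kernel mule1.
Qed.

HB.instance Definition _ := isProbabilityKernel.Build _ _ _ _ R
  (mkcomp_noparam p q) comp_setT.

Definition kernel_comp : R.-pker R ~> R := mkcomp_noparam p q.

(** The integral of the monotone function [q z ]y, +oo[] against [p x] is the
    expectation of its value at the sampler, which is monotone in [x]. *)
Lemma kernel_comp_mono : stochastically_monotone p -> stochastically_monotone q ->
  stochastically_monotone kernel_comp.
Proof.
move=> p_mono q_mono y x1 x2 x12; rewrite /= /kcomp_noparam.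
have mq := measurable_kernel q `]y, +oo[%classic (measurable_itv _).
rewrite !integral_sampler//.
have ms x : measurable_fun [set: measurableTypeR R]
    (fun u => q (sampler p (x, u)) `]y, +oo[%classic).
  exact: measurableT_comp mq (measurable_fun_pair2 _ (@measurable_sampler _ p)).
apply: ge0_le_integral => // u _.
by apply: q_mono; exact: sampler_homo.
Qed.

Lemma cond_law_comp : cond_law P p W V Y -> cond_law P q W Y Z ->
  cond_law P kernel_comp W V Z.
Proof.
move=> condY condZ A B mA mB; rewrite -condZ//.
rewrite (integral_cond_law (f := q ^~ A) condY)//.
exact: measurable_kernel.
Qed.

Lemma cond_law_dirac : (forall x A, measurable A -> p x A = \d_x A) ->
  cond_law P p W V V.
Proof.
move=> pE A B mA mB.
rewrite (eq_integral (fun w => (\1_(V @^-1` A) w)%:E)); last first.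
  by move=> w _; rewrite pE.
rewrite integral_indic//; first by rewrite -[X in measurable X]setTI; exact: mW.
by rewrite -[X in measurable X]setTI; exact: mV.
Qed.

End kernel_composition.

Lemma dirac_mono (R : realType) (p : R.-pker R ~> R) :
  (forall x A, measurable A -> p x A = \d_x A) -> stochastically_monotone p.
Proof.
move=> pE y x1 x2 x12; rewrite !pE// !diracE lee_fin ler_nat.
have [/set_mem/= x1y|//] := boolP (x1 \in _).
rewrite mem_set//=; move: x1y; rewrite !in_itv/= !andbT => /lt_le_trans.
exact.
Qed.

(** * Stationary monotone Markov processes *)

Section history.
Context d (T : measurableType d) (R : realType) (P : probability T R).

Lemma history_preimage (I : Type) (X : I -> {RV P >-> R}) (S : set I) u (B : set R) :
  S u -> measurable B -> history X S (X u @^-1` B).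
Proof.
move=> Su mB; apply: sub_sigma_algebra; exists u => //.
by exists B => //; rewrite setTI.
Qed.

(** The kernel over [s] steps is the [s]-fold composition of [p].  The events
    generated by [X u] belong to the history at time [s + r], so the Markov
    property at that time adds one more step. *)
Lemma discrete_cond_law (p : R.-pker R ~> R) (X : nat -> {RV P >-> R}) (r s : nat) :
    discrete_markov p X -> stochastically_monotone p ->
  exists ps : R.-pker R ~> R, stochastically_monotone ps /\
    forall u, (u <= r)%N -> cond_law P ps (X u) (X r) (X (s + r)%N).
Proof.
move=> markovX p_mono; elim: s => [|s [ps [ps_mono ps_law]]].
  pose p0 : R.-pker R ~> R := kdirac (@measurable_id _ R setT).
  exists p0; split; first exact: dirac_mono.
  by move=> u ur; apply: cond_law_dirac.
exists (kernel_comp ps p); split; first exact: kernel_comp_mono.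
move=> u ur; apply: (cond_law_comp (Y := X (s + r)%N)) => //; first exact: ps_law.
move=> A B mA mB; have [_] := markovX (s + r)%N A mA; apply.
by apply: history_preimage => //=; rewrite (leq_trans ur)// leq_addl.
Qed.

(** At time zero the transition function is the Dirac kernel, whose monotonicity
    has to be checked apart. *)
Lemma continuous_cond_law (p : {nonneg R} -> R.-pker R ~> R)
    (X : {nonneg R} -> {RV P >-> R}) (r s : {nonneg R}) :
    continuous_markov p X ->
    (forall t : {nonneg R}, (0 < t%:num)%R -> stochastically_monotone (p t)) ->
  exists ps : R.-pker R ~> R, stochastically_monotone ps /\
    forall u : {nonneg R}, (u%:num <= r%:num)%R ->
      cond_law P ps (X u) (X r) (X (nng_add s r)).
Proof.
move=> [[p0 _] markovX] p_mono; exists (p s); split.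
  have [s0|s0] := eqVneq s%:num%R 0%R; last first.
    by apply: p_mono; rewrite lt_def s0/=.
  have -> : s = 0%:nng%R by exact/val_inj.
  exact: dirac_mono.
move=> u ur A B mA mB; have [_] := markovX r s A mA.
have -> : nng_add r s = nng_add s r by apply/val_inj; rewrite /= addrC.
by apply; exact: history_preimage.
Qed.

End history.

Section stationary_pairs.
Context d (T : measurableType d) (R : realType) (P : probability T R).
Context (I : Type) (add : I -> I -> I) (X : I -> {RV P >-> R}).
Hypothesis statX : stationary add X.

Lemma stationary_pair (a b s : I) (C : set (R * R)) : measurable C ->
  P ((fun w => (X (add a s) w, X (add b s) w)) @^-1` C) =
  P ((fun w => (X a w, X b w)) @^-1` C).
Proof.
move=> mC; pose t (i : 'I_2) := if i == ord0 then a else b.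
pose B := (fun v : 2.-tuple R => (tnth v ord0, tnth v ord_max)) @^-1` C.
have mB : measurable B.
  rewrite -[X in measurable X]setTI; apply: measurable_fun_pair mC => //;
    exact: measurable_tnth.
have tupleE (F : 'I_2 -> T -> R) : (fun w => [tuple F i w | i < 2]) @^-1` B =
    (fun w => (F ord0 w, F ord_max w)) @^-1` C.
  by apply/funext => w; rewrite /B /= !tnth_mktuple.
by have := statX t s mB; rewrite !tupleE.
Qed.

Lemma stationary_marginal (a s : I) (A : set R) : measurable A ->
  P (X (add a s) @^-1` A) = P (X a @^-1` A).
Proof.
move=> mA; have mA2 : measurable (A `*` [set: R]) by exact: measurableX.
have diagE (Y : T -> R) : (fun w => (Y w, Y w)) @^-1` (A `*` setT) = Y @^-1` A.
  by apply/seteqP; split => [w []|].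
by have := stationary_pair a a s mA2; rewrite !diagE.
Qed.

End stationary_pairs.

Section stationary_monotone.
Context d (T : measurableType d) (R : realType) (P : probability T R).
Context (I : Type) (zero : I) (add : I -> I -> I) (X : I -> {RV P >-> R}).
Hypotheses (add0i : forall i, add zero i = i) (addi0 : forall i, add i zero = i).
Hypothesis statX : stationary add X.

(* What the discrete-time and the continuous-time processes have in common: over
   each duration [s] the transition from time [r] is governed by a monotone
   kernel, as far as the joint laws with the initial state and with the state at
   time [r] are concerned. *)
Hypothesis monoX : forall r s, exists p : R.-pker R ~> R,
  [/\ stochastically_monotone p, cond_law P p (X zero) (X r) (X (add s r)) &
      cond_law P p (X r) (X r) (X (add s r))].

(** Stationarity moves the pair of times [(zero, s)] to [(r, s + r)]; the two
    expectations then differ only in the first argument, [X zero] against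
    [X r]. *)
Lemma expectation_supermodular_noninc (h : R * R -> R) (r s : I) :
    measurable_fun [set: R * R] h -> supermodular h ->
    (forall t, P.-integrable [set: T] (EFin \o (fun w => h (X zero w, X t w)))) ->
  'E_P[fun w => h (X zero w, X (add s r) w)] <= 'E_P[fun w => h (X zero w, X s w)].
Proof.
move=> mh sh ih; rewrite unlock.
have mhE : measurable_fun [set: R * R] (EFin \o h) by exact/measurable_EFinP.
have lawE C (mC : measurable C) := esym (stationary_pair statX zero s r mC).
rewrite add0i in lawE.
have m1 : measurable_fun [set: T] (fun w => (X zero w, X s w)).
  exact: measurable_fun_pair.
have m2 : measurable_fun [set: T] (fun w => (X r w, X (add s r) w)).
  exact: measurable_fun_pair.
rewrite (integral_eq_law m1 m2 lawE mhE).
have [p [p_mono cond0 condr]] := monoX r s.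
apply: (@le_integral_supermodular_kernel _ _ _ P p (X r) (X (add s r))) => //.
- by move=> A mA; rewrite -{1}(add0i r) (stationary_marginal statX).
- exact: ih.
- exact: (integrable_eq_law m1 m2 lawE mhE (ih s)).
Qed.

Section covariances.
Context (f1 f2 : R -> R).
Hypotheses (f1_homo : {homo f1 : x y / (x <= y)%R})
  (f2_homo : {homo f2 : x y / (x <= y)%R}).
Hypotheses (if1 : P.-integrable [set: T] (EFin \o (fun w => f1 (X zero w))))
  (if2 : P.-integrable [set: T] (EFin \o (fun w => f2 (X zero w))))
  (if12 : forall t,
    P.-integrable [set: T] (EFin \o (fun w => (f1 (X zero w) * f2 (X t w))%R))).

Let mf1 : measurable_fun [set: R] f1. Proof. exact: nondecreasing_measurable. Qed.
Let mf2 : measurable_fun [set: R] f2. Proof. exact: nondecreasing_measurable. Qed.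
Let mf2E : measurable_fun [set: R] (EFin \o f2). Proof. exact/measurable_EFinP. Qed.

Let lawX t A : measurable A -> P (X zero @^-1` A) = P (X t @^-1` A).
Proof. by move=> mA; rewrite -{1}(add0i t) (stationary_marginal statX). Qed.

Let if2t t : P.-integrable [set: T] (EFin \o (fun w => f2 (X t w))).
Proof. exact: (integrable_eq_law _ _ (lawX t) mf2E if2). Qed.

Let covE t : covariance P (fun w => f1 (X zero w)) (fun w => f2 (X t w)) =
  \int[P]_w (f1 (X zero w) * f2 (X t w))%:E -
  (\int[P]_w (f1 (X zero w))%:E) * (\int[P]_w (f2 (X t w))%:E).
Proof.
by rewrite covarianceE ?unlock//; apply/Lfun1_integrable;
  [exact: if1|exact: if2t|exact: if12].
Qed.

Lemma covariance_monotone_ge0 t :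
  0 <= covariance P (fun w => f1 (X zero w)) (fun w => f2 (X t w)).
Proof.
rewrite covE sube_ge0; last by apply/orP; right; exact: (integrable_fin_num _ (if12 t)).
have [p [p_mono cond0 _]] := monoX zero t; rewrite addi0 in cond0.
apply: (integral_mul_homo_kernel_ge _ _ p_mono cond0) => //.
- exact: if2t.
- exact: if12.
Qed.

Lemma covariance_monotone_noninc r s :
  covariance P (fun w => f1 (X zero w)) (fun w => f2 (X (add s r) w)) <=
  covariance P (fun w => f1 (X zero w)) (fun w => f2 (X s w)).
Proof.
rewrite !covE -!(integral_eq_law _ _ (lawX _) mf2E)//.
apply: leeB => //.
have := @expectation_supermodular_noninc (fun z => f1 z.1 * f2 z.2)%R r s.
rewrite !expectation.unlock => H; apply: H => //.
- by apply: measurable_funM; exact: measurableT_comp.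
- exact: supermodular_mul.
Qed.

End covariances.
End stationary_monotone.

Theorem theorem2 (R : realType) (d : measure_display) (T : measurableType d)
    (P : probability T R) :
  (forall (p : R.-pker R ~> R) (X : nat -> {RV P >-> R}),
    discrete_markov p X -> stochastically_monotone p -> stationary addn X ->
    (forall h : R * R -> R,
      measurable_fun [set: R * R] h -> supermodular h ->
      (forall t : nat,
        P.-integrable [set: T] (EFin \o (fun w => h (X 0%N w, X t w)))) ->
      forall s t : nat, (s <= t)%N ->
        'E_P[fun w => h (X 0%N w, X t w)] <= 'E_P[fun w => h (X 0%N w, X s w)]) /\
    (forall f1 f2 : R -> R,
      {homo f1 : x y / (x <= y)%R} -> {homo f2 : x y / (x <= y)%R} ->
      P.-integrable [set: T] (EFin \o (fun w => f1 (X 0%N w))) ->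
      P.-integrable [set: T] (EFin \o (fun w => f2 (X 0%N w))) ->
      (forall t : nat,
        P.-integrable [set: T] (EFin \o (fun w => (f1 (X 0%N w) * f2 (X t w))%R))) ->
      (forall t : nat,
        0 <= covariance P (fun w => f1 (X 0%N w)) (fun w => f2 (X t w))) /\
      (forall s t : nat, (s <= t)%N ->
        covariance P (fun w => f1 (X 0%N w)) (fun w => f2 (X t w)) <=
        covariance P (fun w => f1 (X 0%N w)) (fun w => f2 (X s w))))) /\
  (forall (p : {nonneg R} -> R.-pker R ~> R) (X : {nonneg R} -> {RV P >-> R}),
    continuous_markov p X ->
    (forall t : {nonneg R}, (0 < t%:num)%R -> stochastically_monotone (p t)) ->
    stationary (@nng_add R) X ->
    (forall h : R * R -> R,
      measurable_fun [set: R * R] h -> supermodular h ->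
      (forall t : {nonneg R},
        P.-integrable [set: T] (EFin \o (fun w => h (X 0%:nng%R w, X t w)))) ->
      forall s t : {nonneg R}, (s%:num <= t%:num)%R ->
        'E_P[fun w => h (X 0%:nng%R w, X t w)] <=
        'E_P[fun w => h (X 0%:nng%R w, X s w)]) /\
    (forall f1 f2 : R -> R,
      {homo f1 : x y / (x <= y)%R} -> {homo f2 : x y / (x <= y)%R} ->
      P.-integrable [set: T] (EFin \o (fun w => f1 (X 0%:nng%R w))) ->
      P.-integrable [set: T] (EFin \o (fun w => f2 (X 0%:nng%R w))) ->
      (forall t : {nonneg R},
        P.-integrable [set: T]
          (EFin \o (fun w => (f1 (X 0%:nng%R w) * f2 (X t w))%R))) ->
      (forall t : {nonneg R},
        0 <= covariance P (fun w => f1 (X 0%:nng%R w)) (fun w => f2 (X t w))) /\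
      (forall s t : {nonneg R}, (s%:num <= t%:num)%R ->
        covariance P (fun w => f1 (X 0%:nng%R w)) (fun w => f2 (X t w)) <=
        covariance P (fun w => f1 (X 0%:nng%R w)) (fun w => f2 (X s w))))).
Proof.
split=> [p X markovX p_mono statX|p X markovX p_mono statX].
  have monoX r s : exists q : R.-pker R ~> R,
      [/\ stochastically_monotone q, cond_law P q (X 0%N) (X r) (X (s + r)%N) &
          cond_law P q (X r) (X r) (X (s + r)%N)].
    have [q [q_mono qP]] := discrete_cond_law r s markovX p_mono.
    by exists q; split => //; exact: qP.
  split=> [h mh sh ih s t st|f1 f2 mono1 mono2 i1 i2 i12].
    rewrite -(subnKC st).
    exact: (expectation_supermodular_noninc add0n statX monoX _ _ mh sh ih).
  split=> [t|s t st]; first exact: (covariance_monotone_ge0 add0n addn0 statX monoX).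
  by rewrite -(subnKC st); exact: (covariance_monotone_noninc add0n statX monoX).
have add0i (t : {nonneg R}) : nng_add 0%:nng%R t = t by apply/val_inj; rewrite /= add0r.
have addi0 (t : {nonneg R}) : nng_add t 0%:nng%R = t by apply/val_inj; rewrite /= addr0.
have monoX (r s : {nonneg R}) : exists q : R.-pker R ~> R,
    [/\ stochastically_monotone q, cond_law P q (X 0%:nng%R) (X r) (X (nng_add s r)) &
        cond_law P q (X r) (X r) (X (nng_add s r))].
  have [q [q_mono qP]] := continuous_cond_law r s markovX p_mono.
  by exists q; split => //; apply: qP => /=; rewrite ?lexx ?ge0.
have diff (s t : {nonneg R}) : (s%:num <= t%:num)%R -> exists r, t = nng_add s r.
  rewrite -subr_ge0 => st; exists (NngNum st); apply/val_inj => /=.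
  by rewrite addrC subrK.
split=> [h mh sh ih s t /diff[r ->]|f1 f2 mono1 mono2 i1 i2 i12].
  exact: (expectation_supermodular_noninc add0i statX monoX _ _ mh sh ih).
split=> [t|s t /diff[r ->]]; first exact: (covariance_monotone_ge0 add0i addi0 statX monoX).
exact: (covariance_monotone_noninc add0i statX monoX).
Qed.
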